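(* Let $q\in(0,1]$. Consider the parametric convex semi-infinite problem described in the context, and let $((\bar c,\bar b),\bar x)\in\operatorname{gph}\mathcal{S}$. Suppose that the Extended Nürnberger Condition (ENC) is satisfied at $((\bar c,\bar b),\bar x)$. Then $$\operatorname{clm}_q\mathcal{S}((\bar c,\bar b),\bar x)=\operatorname{clm}_q\mathcal{S}_{\bar c}(\bar b,\bar x).$$
   Context: Setting: $T$ is a compact subset of a metric space $Z$ with $T\neq Z$; $f:\mathbb{R}^n\to\mathbb{R}$ and $g_t:\mathbb{R}^n\to\mathbb{R}$ ($t\in T$) are convex, with $(t,x)\mapsto g_t(x)$ continuous on $T\times\mathbb{R}^n$. $\mathcal{C}(T,\mathbb{R})$ is the space of continuous $b:T\to\mathbb{R}$, $t\mapsto b_t$, with $\|b\|_\infty=\max_t|b_t|$. For $(c,b)\in\mathbb{R}^n\times\mathcal{C}(T,\mathbb{R})$, $P(c,b)$: minimize $f(x)+\langle c,x\rangle$ subject to $g_t(x)\le b_t$, $t\in T$. Parameter norm $\|(c,b)\|=\max\{\|c\|,\|b\|_\infty\}$ (Euclidean on $\mathbb{R}^n$). $\mathcal{S}(c,b)$ is the optimal solution set of $P(c,b)$, $\mathcal{S}_c(b):=\mathcal{S}(c,b)$. Active set $T_b(x)=\{t\in T: g_t(x)=b_t\}$. Slater condition for $P(c,b)$: some $\hat x$ has $g_t(\hat x)<b_t$ for all $t$. ENC holds at $((\bar c,\bar b),\bar x)$ if $P(\bar c,\bar b)$ satisfies the Slater condition and there is no $D\subset T_{\bar b}(\bar x)$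 with $|D|<n$ such that $-(\partial f(\bar x)+\bar c)\cap\operatorname{cone}\big(\bigcup_{t\in D}\partial g_t(\bar x)\big)\neq\emptyset$, where $\partial$ is the convex subdifferential and cone is the convex conical hull, always containing $0_n$ ($\operatorname{cone}(\emptyset)=\{0_n\}$). For a set-valued $S:Y\rightrightarrows X$ between metric spaces and $(\bar y,\bar x)\in\operatorname{gph}S$, $\operatorname{clm}_q S(\bar y,\bar x):=\liminf_{y\to\bar y,\ x\to\bar x,\ x\in S(y)} d(y,\bar y)^q/d(x,S(\bar y))$. *)

(* Defs.v *)
From Stdlib Require List.
From HB Require Import structures.
From mathcomp Require Import all_boot all_order all_algebra.
From mathcomp Require Import all_classical all_reals all_analysis.

Set Implicit Arguments.
Unset Strict Implicit.
Unset Printing Implicit Defensive.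

Import Order.TTheory GRing.Theory Num.Theory.
Local Open Scope classical_set_scope.
Local Open Scope ring_scope.

Section Defs.
Variable R : realType.

Definition is_metric (Z : Type) (d : Z -> Z -> R) : Prop :=
  (forall z w, 0 <= d z w) /\ (forall z w, d z w = 0 <-> z = w) /\
  (forall z w, d z w = d w z) /\ (forall z w u, d z u <= d z w + d w u).

Definition open_in (Z : Type) (d : Z -> Z -> R) (U : set Z) : Prop :=
  forall z, U z -> exists2 e : R, 0 < e & forall w, d z w < e -> U w.

Definition compact_in (Z : Type) (d : Z -> Z -> R) (T : set Z) : Prop :=
  forall (I : Type) (U : I -> set Z),
    (forall i, open_in d (U i)) ->
    (forall z, T z -> exists i, U i z) ->
    exists s : list I, forall z, T z -> exists i, List.In i s /\ U i z.

Definition inner (n : nat) (u v : 'rV[R]_n) : R := \sum_(i < n) u ord0 i * v ord0 i.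
Definition enorm (n : nat) (u : 'rV[R]_n) : R := Num.sqrt (inner u u).

Definition convex_fun (n : nat) (h : 'rV[R]_n -> R) : Prop :=
  forall (x y : 'rV[R]_n) (l : R), 0 <= l <= 1 ->
    h (l *: x + (1 - l) *: y) <= l * h x + (1 - l) * h y.

Definition subdiff (n : nat) (h : 'rV[R]_n -> R) (x : 'rV[R]_n) : set 'rV[R]_n :=
  [set u | forall y, h x + inner u (y - x) <= h y].

(* convex conical hull (always contains 0) *)
Definition ccone (n : nat) (A : set 'rV[R]_n) : set 'rV[R]_n :=
  [set v | exists (m : nat) (lam : 'I_m -> R) (a : 'I_m -> 'rV[R]_n),
      (forall i, 0 <= lam i) /\ (forall i, A (a i)) /\ v = \sum_(i < m) lam i *: a i].

Definition cont_on (Z : Type) (d : Z -> Z -> R) (T : set Z) (b : sig T -> R) : Prop :=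
  forall (t : sig T) (e : R), 0 < e -> exists2 del : R, 0 < del &
    forall s : sig T, d (proj1_sig t) (proj1_sig s) < del -> `|b s - b t| < e.

Definition joint_cont (Z : Type) (d : Z -> Z -> R) (T : set Z) (n : nat)
  (g : sig T -> 'rV[R]_n -> R) : Prop :=
  forall (t : sig T) (x : 'rV[R]_n) (e : R), 0 < e -> exists2 del : R, 0 < del &
    forall (s : sig T) (y : 'rV[R]_n),
      d (proj1_sig t) (proj1_sig s) < del -> enorm (y - x) < del ->
      `|g s y - g t x| < e.

(* sup norm ||b||_oo = max_t |b_t| (a max by compactness/continuity) *)
Definition supnorm (Z : Type) (T : set Z) (b : sig T -> R) : R :=
  sup [set `|b t| | t in [set: sig T]].

Definition feasible (Z : Type) (T : set Z) (n : nat) (g : sig T -> 'rV[R]_n -> R)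
  (b : sig T -> R) : set 'rV[R]_n := [set x | forall t, g t x <= b t].

Definition Sol (Z : Type) (T : set Z) (n : nat) (f : 'rV[R]_n -> R)
  (g : sig T -> 'rV[R]_n -> R) (cb : 'rV[R]_n * (sig T -> R)) : set 'rV[R]_n :=
  [set x | feasible g cb.2 x /\
     forall y, feasible g cb.2 y -> f x + inner cb.1 x <= f y + inner cb.1 y].

Definition slater (Z : Type) (T : set Z) (n : nat) (g : sig T -> 'rV[R]_n -> R)
  (b : sig T -> R) : Prop := exists xh, forall t, g t xh < b t.

Definition active (Z : Type) (T : set Z) (n : nat) (g : sig T -> 'rV[R]_n -> R)
  (b : sig T -> R) (x : 'rV[R]_n) : set (sig T) := [set t | g t x = b t].

(* Extended Nurnberger Condition at ((cbar,bbar),xbar); finite subsets D of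
   the active set with |D| < n are represented by lists of size < n. *)
Definition ENC (Z : Type) (T : set Z) (n : nat) (f : 'rV[R]_n -> R)
  (g : sig T -> 'rV[R]_n -> R) (cbar : 'rV[R]_n) (bbar : sig T -> R)
  (xbar : 'rV[R]_n) : Prop :=
  slater g bbar /\
  ~ exists D : list (sig T),
      (size D < n)%N /\ (forall t, List.In t D -> active g bbar xbar t) /\
      exists v, (exists2 u, subdiff f xbar u & v = - (u + cbar)) /\
        ccone [set w | exists2 t, List.In t D & subdiff (g t) xbar w] v.

(* d(x,A) as an extended real (inf over A; +oo if A is empty) *)
Definition edist (X : Type) (dX : X -> X -> R) (x : X) (A : set X) : \bar R :=
  ereal_inf [set (dX x z)%:E | z in A].

(* the quotient d(y,ybar)^q / d(x,S(ybar)), with a/0 := +oo (in particular 0/0 := +oo)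
   and a/(+oo) := 0 *)
Definition quot (p : R) (dd : \bar R) : \bar R :=
  match dd with
  | r%:E => if 0 < r then (p / r)%:E else +oo%E
  | +oo%E => 0%E
  | -oo%E => +oo%E
  end.

(* clm_q S(ybar,xbar) := liminf_{y->ybar, x->xbar, x in S(y)} d(y,ybar)^q/d(x,S(ybar)),
   for S : Y ==> X, where Y is the set of points satisfying [dom]. *)
Definition clm (Y X : Type) (dom : Y -> Prop) (dY : Y -> Y -> R) (dX : X -> X -> R)
  (S : Y -> set X) (q : R) (ybar : Y) (xbar : X) : \bar R :=
  ereal_sup [set ereal_inf
      [set quot (powR (dY yx.1 ybar) q) (edist dX yx.2 (S ybar)) |
         yx in [set yx : Y * X | dom yx.1 /\ dY yx.1 ybar < del /\
                                 dX yx.2 xbar < del /\ S yx.1 yx.2]]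
    | del in [set del : R | 0 < del]].

End Defs.

(* Main.v *)
(** The point is that, for [(c, b)] near [(cbar, bbar)], an optimal solution [x] of [P(c, b)] near
    [xbar] is still optimal for [P(cbar, b)]; the two liminf then range over the same points up to
    replacing [c] by [cbar], which only decreases the quotient.

    Suppose this fails, and let an ultrafilter describe a sequence of counterexamples converging to
    [((cbar, bbar), xbar)]. Each of them satisfies the KKT conditions up to an error tending to 0,
    with at most [n + 1] subgradients by Caratheodory; indices, subgradients and weights converge
    by compactness of [T]. In the limit, the Slater condition gives the objective a positive weight,
    so that [-(u + cbar)] lies in the cone of some subgradients of constraints active at [xbar]. By
    ENC and Caratheodory for cones, it is a combination with positive coefficients of [n] linearly
    independent ones. Positivity and independence persist near the limit: [-(u' + cbar)], with [u']
    the subgradient of [f] before the limit, is a positive combination of subgradients of active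
    constraints, which proves optimality for [P(cbar, b)]. *)

Require Import Defs.
From HB Require Import structures.
From mathcomp Require Import all_boot all_order all_algebra.
From mathcomp Require Import all_classical all_reals all_analysis.
From mathcomp Require Import ring lra.

Set Implicit Arguments.
Unset Strict Implicit.
Unset Printing Implicit Defensive.

Import Order.TTheory GRing.Theory Num.Theory.
Import numFieldNormedType.Exports.
Local Open Scope classical_set_scope.
Local Open Scope ring_scope.

(** * Inner product and convex functions *)

Section Inner.
Context {R : realType} {n : nat}.
Implicit Types (u v w : 'rV[R]_n) (a : R).

Lemma innerC u v : inner u v = inner v u.
Proof. by apply: eq_bigr => i _; rewrite mulrC. Qed.

Lemma innerDl u v w : inner (u + v) w = inner u w + inner v w.
Proof. by rewrite /inner -big_split; apply: eq_bigr => i _; rewrite mxE mulrDl. Qed.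

Lemma innerDr u v w : inner w (u + v) = inner w u + inner w v.
Proof. by rewrite innerC innerDl !(innerC w). Qed.

Lemma innerZl a u v : inner (a *: u) v = a * inner u v.
Proof. by rewrite /inner mulr_sumr; apply: eq_bigr => i _; rewrite mxE mulrA. Qed.

Lemma innerZr a u v : inner u (a *: v) = a * inner u v.
Proof. by rewrite innerC innerZl innerC. Qed.

Lemma innerNl u v : inner (- u) v = - inner u v.
Proof. by rewrite -scaleN1r innerZl mulN1r. Qed.

Lemma innerNr u v : inner u (- v) = - inner u v.
Proof. by rewrite innerC innerNl innerC. Qed.

Lemma inner0l v : inner 0 v = 0.
Proof. by rewrite -(scale0r 0) innerZl mul0r. Qed.

Lemma inner_suml I (r : seq I) (P : pred I) (F : I -> 'rV[R]_n) v :
  inner (\sum_(i <- r | P i) F i) v = \sum_(i <- r | P i) inner (F i) v.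
Proof.
by elim/big_rec2: _ => [|i x y _ <-]; rewrite ?inner0l ?innerDl.
Qed.

Lemma inner_ge0 u : 0 <= inner u u.
Proof. by apply: sumr_ge0 => i _; rewrite -expr2 sqr_ge0. Qed.

Lemma inner_eq0 u : inner u u = 0 -> u = 0.
Proof.
move=> /eqP; rewrite /inner psumr_eq0 => [/allP h|i _]; last by rewrite -expr2 sqr_ge0.
apply/rowP => i; rewrite mxE; have := h i (mem_index_enum _).
by rewrite /= mulf_eq0 orbb => /eqP.
Qed.

Lemma inner_delta u i : inner u (delta_mx ord0 i) = u ord0 i.
Proof.
rewrite /inner (bigD1 i) //= big1 => [|j ji]; rewrite mxE ?eqxx ?mulr1 ?addr0 //.
by rewrite (negbTE ji) andbF mulr0.
Qed.

Lemma coord_norm_le u i : `|u ord0 i| <= `|u|.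
Proof.
rewrite [leRHS]mx_normrE; apply: (le_bigmax _ (fun ij : 'I_1 * 'I_n => `|u ij.1 ij.2|) (ord0, i)).
Qed.

Lemma norm_leP u a : 0 <= a -> (forall i, `|u ord0 i| <= a) -> `|u| <= a.
Proof.
move=> a0 h; rewrite [leLHS]mx_normrE; apply: bigmax_le => // -[i j] _ /=.
by rewrite ord1.
Qed.

Lemma enorm_ge0 u : 0 <= enorm u.
Proof. exact: sqrtr_ge0. Qed.

Lemma enorm0 : enorm (0 : 'rV[R]_n) = 0.
Proof. by rewrite /enorm inner0l sqrtr0. Qed.

Lemma norm_le_enorm u : `|u| <= enorm u.
Proof.
apply: norm_leP => [|i]; first exact: enorm_ge0.
rewrite -sqrtr_sqr ler_wsqrtr // /inner (bigD1 i) //= expr2 lerDl.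
by apply: sumr_ge0 => j _; rewrite -expr2 sqr_ge0.
Qed.

Lemma inner_self_le u : inner u u <= n%:R * `|u| ^+ 2.
Proof.
rewrite /inner; apply: (@le_trans _ _ (\sum_(i < n) `|u| ^+ 2)).
  apply: ler_sum => i _; rewrite -expr2 -real_normK ?num_real //.
  by rewrite ler_pXn2r ?nnegrE // coord_norm_le.
by rewrite sumr_const card_ord mulr_natl.
Qed.

Lemma enorm_le_norm u : enorm u <= n.+1%:R * `|u|.
Proof.
rewrite -[leRHS]ger0_norm ?mulr_ge0 // -sqrtr_sqr ler_wsqrtr //.
apply: (le_trans (inner_self_le u)); rewrite exprMn ler_wpM2r ?sqr_ge0 //.
by rewrite -natrX ler_nat expnS expn1 mulSn (leq_trans (leqnSn n)) // leq_addr.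
Qed.

End Inner.

Section Convex.
Context {R : realType} {n : nat}.
Implicit Types (h : 'rV[R]_n -> R) (x y d e : 'rV[R]_n).

Lemma convex_mid h x y : convex_fun h ->
  h (2^-1 *: x + 2^-1 *: y) <= 2^-1 * h x + 2^-1 * h y.
Proof.
move=> hc; have {2 4}-> : (2^-1 : R) = 1 - 2^-1 by lra.
by apply: hc; lra.
Qed.

(** Induction on the coordinates: a point with one more coordinate is the midpoint of a point on an
    axis through [x] and of a point using the earlier coordinates only. Both displacements are
    doubled, hence the induction over all radii. *)
Lemma convex_bounded_above h x : convex_fun h ->
  exists M, forall y, `|y| <= 1 -> h (x + y) <= M.
Proof.
move=> hc.
have bd (r : seq 'I_n) : forall rho : R, 0 <= rho -> exists M : R, forall y,
    `|y| <= rho -> h (x + \sum_(i <- r) y ord0 i *: delta_mx ord0 i) <= M.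
  elim: r => [|i r IH] rho rho0.
    by exists (h x) => y _; rewrite big_nil addr0.
  have [M hM] := IH (2 * rho) ltac:(lra).
  pose e : 'rV[R]_n := delta_mx ord0 i.
  pose M1 := Num.max (h (x + (2 * rho) *: e)) (h (x - (2 * rho) *: e)).
  have hM1 s : `|s| <= 2 * rho -> h (x + s *: e) <= M1.
    move=> sb; have [r0|r0] := eqVneq rho 0.
      have -> : s = 2 * rho.
        by apply/eqP; rewrite r0 mulr0 -normr_le0 (le_trans sb) // r0 mulr0.
      by rewrite le_max lexx.
    have rp : 0 < rho by rewrite lt0r r0.
    have /andP[sl su] : - (2 * rho) <= s <= 2 * rho by rewrite -ler_norml.
    pose l := (s + 2 * rho) / (4 * rho).
    have l01 : 0 <= l <= 1.
      by rewrite divr_ge0 ?ler_pdivrMr ?mul1r; lra.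
    have -> : x + s *: e =
        l *: (x + (2 * rho) *: e) + (1 - l) *: (x - (2 * rho) *: e).
      by apply/rowP => j; rewrite !mxE /l; field.
    apply: (le_trans (hc _ _ _ l01)).
    have -> : M1 = l * M1 + (1 - l) * M1 by ring.
    by apply: lerD; apply: ler_wpM2l; rewrite ?le_max ?lexx ?orbT //; lra.
  exists (2^-1 * M1 + 2^-1 * M) => y yb; rewrite big_cons.
  have -> : x + (y ord0 i *: e + \sum_(j <- r) y ord0 j *: delta_mx ord0 j) =
      2^-1 *: (x + (2 * y ord0 i) *: e) +
      2^-1 *: (x + \sum_(j <- r) (2 *: y) ord0 j *: delta_mx ord0 j).
    have -> : \sum_(j <- r) (2 *: y) ord0 j *: delta_mx ord0 j =
        2 *: \sum_(j <- r) y ord0 j *: delta_mx ord0 j :> 'rV[R]_n.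
      by rewrite scaler_sumr; apply: eq_bigr => j _; rewrite mxE scalerA.
    by apply/rowP => j; rewrite !mxE; field.
  apply: (le_trans (convex_mid _ _ hc)); apply: lerD; rewrite ler_pM2l ?invr_gt0 //.
    by apply: hM1; rewrite normrM ger0_norm // ler_pM2l // (le_trans (coord_norm_le _ _)).
  by apply: hM; rewrite normrZ ger0_norm // ler_pM2l.
have [M hM] := bd (index_enum 'I_n) 1 ler01; exists M => y /hM.
by rewrite -row_sum_delta.
Qed.

(** The bound on a unit ball, scaled towards [x], bounds [h] from above near [x]; reflection through
    [x] turns this into a lower bound. *)
Lemma convex_continuous h x (eps : R) : convex_fun h -> 0 < eps ->
  exists2 del : R, 0 < del & forall y, `|y - x| < del -> `|h y - h x| < eps.
Proof.
move=> hc eps0; have [M hM] := convex_bounded_above x hc.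
have K0 : 0 <= M - h x by rewrite subr_ge0 -[x in h x]addr0 hM // normr0 ler01.
pose s := Num.min 1 (eps / (M - h x + 1)).
have s0 : 0 < s by rewrite lt_min ltr01 divr_gt0 //; lra.
have s1 : s <= 1 by rewrite ge_min lexx.
have sK : s * (M - h x) < eps.
  have se : s * (M - h x + 1) <= eps by rewrite -ler_pdivlMr ?ge_min ?lexx ?orbT //; lra.
  by lra.
have up z : `|z| < s -> h (x + z) <= h x + s * (M - h x).
  move=> zs; have -> : x + z = s *: (x + s^-1 *: z) + (1 - s) *: x.
    by apply/rowP => j; rewrite !mxE; field; exact: lt0r_neq0.
  apply: (le_trans (hc _ _ _ _)); first by rewrite ltW.
  have : h (x + s^-1 *: z) <= M.
    by apply: hM; rewrite normrZ normfV gtr0_norm // mulrC ler_pdivrMr // mul1r ltW.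
  by move=> /(ler_wpM2l (ltW s0)); lra.
exists s => // y ys; have := up _ ys; rewrite addrC subrK => hy.
have := up (- (y - x)); rewrite normrN => /(_ ys) hy'.
have := convex_mid y (x - (y - x)) hc.
have -> : 2^-1 *: y + 2^-1 *: (x - (y - x)) = x by apply/rowP => j; rewrite !mxE; field.
move=> hm; rewrite ltr_norml; apply/andP; split; lra.
Qed.

(* [alpha] is the right derivative of [h] at [x] along [d]. *)
Lemma convex_slope h x d : convex_fun h -> exists alpha : R,
  (forall s, h x + s * alpha <= h (x + s *: d)) /\
  forall beta, (forall s, 0 <= s -> h x + s * beta <= h (x + s *: d)) -> beta <= alpha.
Proof.
move=> hc; pose E := [set (h (x + s *: d) - h x) / s | s in [set s : R | 0 < s]].
have E0 : E !=set0 by exists ((h (x + 1 *: d) - h x) / 1), 1 => //=; exact: ltr01.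
(* Chords to the left of [x] have at most the slope of chords to the right. *)
have three s t : 0 < s -> 0 < t -> (h x - h (x - t *: d)) / t <= (h (x + s *: d) - h x) / s.
  move=> s0 t0; have st0 : 0 < s + t by lra.
  have l01 : 0 <= t / (s + t) <= 1.
    by rewrite divr_ge0 ?ler_pdivrMr ?mul1r; lra.
  have := hc (x + s *: d) (x - t *: d) _ l01.
  have -> : t / (s + t) *: (x + s *: d) + (1 - t / (s + t)) *: (x - t *: d) = x.
    by apply/rowP => j; rewrite !mxE; field; exact: lt0r_neq0.
  move=> /(ler_wpM2l (ltW st0)).
  have -> : (s + t) * (t / (s + t) * h (x + s *: d) + (1 - t / (s + t)) * h (x - t *: d)) =
    t * h (x + s *: d) + s * h (x - t *: d) by field; exact: lt0r_neq0.
  by move=> H; rewrite ler_pdivrMr // mulrAC ler_pdivlMr //; lra.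
have Elb t : 0 < t -> lbound E ((h x - h (x - t *: d)) / t).
  by move=> t0 _ [s s0 <-]; exact: three.
exists (inf E); split=> [s|beta hb].
  have [s0|s0|->] := ltgtP s 0.
  - have t0 : 0 < - s by lra.
    have := lb_le_inf E0 (Elb _ t0); rewrite ler_pdivrMr // scaleNr opprK; lra.
  - have : inf E <= (h (x + s *: d) - h x) / s.
      by apply: ge_inf; [exists ((h x - h (x - 1 *: d)) / 1); exact: Elb|exists s].
    by rewrite ler_pdivlMr //; lra.
  - by rewrite scale0r mul0r !addr0.
apply: lb_le_inf => // _ [s s0 <-]; rewrite ler_pdivlMr //.
by have := hb s (ltW s0); lra.
Qed.

Definition affine_along h e (gam : R) :=
  forall y s, h (y + s *: e) = h y + s * gam.

(* The minorant is y |-> inf_s (h (y + s d) - s alpha). *)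
Lemma affine_minorant h x d alpha : convex_fun h ->
  (forall s, h x + s * alpha <= h (x + s *: d)) ->
  exists h', [/\ convex_fun h', (forall y, h' y <= h y), h' x = h x,
    affine_along h' d alpha &
    forall e gam, affine_along h e gam -> affine_along h' e gam].
Proof.
move=> hc hx; pose E y := [set h (y + s *: d) - s * alpha | s in [set: R]].
have E0 y : E y !=set0 by exists (h (y + 0 *: d) - 0 * alpha), 0.
have Elb y : has_lbound (E y).
  (* The midpoint of [y + s *: d] and of the reflection of [y] through [x] lies on the line through
     [x] along [d], where [hx] applies. *)
  exists (2 * h x - h (x - (y - x))) => _ [s _ <-].
  have := hx (s / 2); have := convex_mid (y + s *: d) (x - (y - x)) hc.
  have -> : 2^-1 *: (y + s *: d) + 2^-1 *: (x - (y - x)) = x + (s / 2) *: d.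
    by apply/rowP => j; rewrite !mxE; field.
  by lra.
have le y s : inf (E y) <= h (y + s *: d) - s * alpha by apply: ge_inf => //; exists s.
(* Half of affinity along [e]; the step [- s] gives the other half. *)
have shift y e s gam : (forall z, h (z + s *: e) = h z + s * gam) ->
    inf (E y) + s * gam <= inf (E (y + s *: e)).
  move=> he; apply: lb_le_inf => // _ [t _ <-].
  have := le y t; have -> : y + s *: e + t *: d = y + t *: d + s *: e by rewrite addrAC.
  by rewrite he; lra.
exists (fun y => inf (E y)); split.
- move=> y z l /andP[l0 l1]; apply/ler_addgt0Pr => eps eps0.
  have [_ [s _ <-] hs] := inf_adherent eps0 (conj (E0 y) (Elb y)).
  have [_ [t _ <-] ht] := inf_adherent eps0 (conj (E0 z) (Elb z)).
  have := le (l *: y + (1 - l) *: z) (l * s + (1 - l) * t).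
  have -> : l *: y + (1 - l) *: z + (l * s + (1 - l) * t) *: d =
      l *: (y + s *: d) + (1 - l) *: (z + t *: d).
    by apply/rowP => j; rewrite !mxE; ring.
  have := hc (y + s *: d) (z + t *: d) l; rewrite l0 l1 => /(_ isT).
  move: (ltW hs) (ltW ht) => /(ler_wpM2l l0) hs' /ler_wpM2l-/(_ (1 - l)).
  by move=> /(_ ltac:(lra)); lra.
- by move=> y; have := le y 0; rewrite scale0r mul0r addr0 subr0.
- apply/le_anti/andP; split; first by have := le x 0; rewrite scale0r mul0r addr0 subr0.
  by apply: lb_le_inf => // _ [s _ <-]; have := hx s; lra.
- have key y s : inf (E y) + s * alpha <= inf (E (y + s *: d)).
    apply: lb_le_inf => // _ [t _ <-]; have := le y (s + t).
    by rewrite scalerDl addrA; lra.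
  move=> y s; apply/le_anti; rewrite key andbT.
  by have := key (y + s *: d) (- s); rewrite scaleNr addrK; lra.
- move=> e gam he y s; apply/le_anti; rewrite shift ?andbT => [|z]; last exact: he.
  have := shift (y + s *: e) e (- s) gam (fun z => he z (- s)).
  by rewrite scaleNr addrK; lra.
Qed.

(** Hahn-Banach in finite dimension: [h] is replaced by smaller convex functions with the same value
    at [x], affine first along [d] with slope [alpha], then along each basis vector. The last one is
    affine, with gradient [v]. *)
Lemma subdiff_dir h x d beta : convex_fun h ->
  (forall s, 0 <= s -> h x + s * beta <= h (x + s *: d)) ->
  exists2 v, subdiff h x v & beta <= inner v d.
Proof.
move=> hc hb; have [alpha [ha /(_ _ hb) ba]] := convex_slope x d hc.
have iter (r : seq 'I_n) : exists h' gam,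
    [/\ convex_fun h', (forall y, h' y <= h y), h' x = h x, affine_along h' d alpha &
      forall i, i \in r -> affine_along h' (delta_mx ord0 i) (gam i)].
  elim: r => [|i r [h' [gam [h'c h'h h'x h'd h'r]]]].
    by have [h' [? ? ? ? _]] := affine_minorant hc ha; exists h', (fun=> 0).
  have [al [hal _]] := convex_slope x (delta_mx ord0 i) h'c.
  have [h2 [h2c h2h h2x h2i h2r]] := affine_minorant h'c hal.
  exists h2, (fun j => if j == i then al else gam j); split=> //.
  - by move=> y; exact: le_trans (h2h y) (h'h y).
  - by rewrite h2x.
  - exact: h2r.
  - by move=> j; rewrite inE; case: eqVneq => [-> _|_ /= jr] //; apply: h2r; exact: h'r.
have [h' [gam [h'c h'h h'x h'd h'r]]] := iter (index_enum 'I_n).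
pose v : 'rV[R]_n := \row_i gam i.
have sums y z (r : seq 'I_n) : h' (z + \sum_(i <- r) y ord0 i *: delta_mx ord0 i) =
    h' z + \sum_(i <- r) v ord0 i * y ord0 i.
  elim: r z => [|i r IH] z; first by rewrite !big_nil !addr0.
  by rewrite !big_cons addrA IH h'r ?mem_index_enum // mxE addrA (mulrC (gam i)).
have hv y : h' (x + y) = h x + inner v y.
  by rewrite {1}(row_sum_delta y) sums h'x.
exists v => [y|].
  by rewrite -hv addrC subrK.
have := hv (1 *: d); rewrite h'd h'x scale1r mul1r => /addrI <-; exact: ba.
Qed.

Lemma subdiff_nonempty h x : convex_fun h -> subdiff h x !=set0.
Proof.
move=> hc; have [|v hv _] := @subdiff_dir h x 0 0 hc; last by exists v.
by move=> s _; rewrite mulr0 scaler0 !addr0.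
Qed.

Lemma subdiff_convex h x (I : finType) (P : pred I) (lam : I -> R) (w : I -> 'rV[R]_n) :
  (forall i, P i -> 0 <= lam i) -> \sum_(i | P i) lam i = 1 ->
  (forall i, P i -> subdiff h x (w i)) -> subdiff h x (\sum_(i | P i) lam i *: w i).
Proof.
move=> l0 l1 hw y; rewrite inner_suml -[h x]mul1r -[h y]mul1r -l1 !mulr_suml -big_split.
by apply: ler_sum => i Pi; rewrite /= innerZl -mulrDr ler_wpM2l ?l0 //; exact: hw.
Qed.

End Convex.

(** * Convex combinations and Caratheodory's theorem *)

Section ConvexCombinations.
Context {R : realType}.

(** A multiple of a linear dependence of the rows is subtracted, as large as nonnegativity of the
    coefficients allows; then one coefficient vanishes. *)
Lemma conic_drop m n (A : 'M[R]_(m, n)) (lam : 'rV[R]_m) :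
  (forall i, 0 <= lam ord0 i) -> ~~ row_free A ->
  exists j (mu : 'rV[R]_m),
    [/\ forall i, 0 <= mu ord0 i, mu ord0 j = 0 & mu *m A = lam *m A].
Proof.
move=> lam0; rewrite -kermx_eq0 => /rowV0Pn[v /sub_kermxP vA v0].
have [w [i [wA wi]]] : exists (w : 'rV[R]_m) i, w *m A = 0 /\ 0 < w ord0 i.
  have [i vi] : exists i, v ord0 i != 0.
    apply/existsP; apply: contraNT v0; rewrite negb_exists => /forallP h.
    by apply/eqP/rowP => i; rewrite mxE; exact/eqP/negbNE/h.
  case: (ltgtP (v ord0 i) 0) => [vi0|vi0|vi0]; last by rewrite vi0 eqxx in vi.
    by exists (- v), i; rewrite mulNmx vA oppr0 mxE oppr_gt0.
  by exists v, i.
case: (@arg_minP _ _ _ i (fun j => 0 < w ord0 j) (fun j => lam ord0 j / w ord0 j) wi).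
move=> j wj jmin; exists j, (lam - (lam ord0 j / w ord0 j) *: w); split.
- move=> k; rewrite !mxE subr_ge0; have [wk|wk] := ltP 0 (w ord0 k).
    by rewrite -ler_pdivlMr //; exact: jmin.
  by rewrite (le_trans _ (lam0 k)) // mulr_ge0_le0 // divr_ge0 // ltW.
- by rewrite !mxE divfK ?subrr // lt0r_neq0.
- by rewrite mulmxBl -scalemxAl wA scaler0 subr0.
Qed.

(* Caratheodory's theorem for convex cones. *)
Lemma conic_select m n (A : 'M[R]_(m, n)) (lam : 'rV[R]_m) :
  (forall i, 0 <= lam ord0 i) ->
  exists k (s : 'I_k -> 'I_m) (mu : 'rV[R]_k),
    [/\ forall i, 0 < mu ord0 i, row_free (rowsub s A) & mu *m rowsub s A = lam *m A].
Proof.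
elim: m A lam => [|m IH] A lam lam0.
  exists 0%N, id, lam; split=> [[]//||]; first by rewrite -row_leq_rank.
  by rewrite mul_mx_rowsub || (congr (_ *m _); apply/matrixP => -[]).
(* Either a coefficient can be made zero, and the induction hypothesis applies without row [j], or
   all rows are kept. *)
have [[j [mu [mu0 muj muA]]]|pos] :
    (exists j (mu : 'rV[R]_m.+1),
      [/\ forall i, 0 <= mu ord0 i, mu ord0 j = 0 & mu *m A = lam *m A]) \/
    (row_free A /\ forall i, 0 < lam ord0 i).
  have [Af|/(conic_drop lam0)] := boolP (row_free A); last by move=> ?; left.
  have [/forallP|] := boolP [forall i, 0 < lam ord0 i]; first by right.
  rewrite negb_forall => /existsP[j]; rewrite lt0r lam0 andbT negbK => /eqP lj.
  by left; exists j, lam.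
  have [k [s [nu [nu0 free nuA]]]] := IH (rowsub (lift j) A) (colsub (lift j) mu)
    (fun i => ltac:(rewrite mxE; exact: mu0)).
  exists k, (lift j \o s), nu; rewrite -muA; split=> //.
    by rewrite rowsub_comp.
  rewrite rowsub_comp nuA; apply/rowP => l; rewrite !mxE (bigD1_ord j) //= muj mul0r add0r.
  by apply: eq_bigr => i _; rewrite !mxE.
exists m.+1, id, lam; case: pos => Af lp.
have -> : rowsub id A = A by apply/matrixP => i l; rewrite mxE.
by split.
Qed.

Context {n : nat}.
Implicit Types (A : set 'rV[R]_n) (v : 'rV[R]_n).

Definition convex_comb A m v := exists (lam : 'I_m -> R) (a : 'I_m -> 'rV[R]_n),
  [/\ forall i, 0 <= lam i, \sum_i lam i = 1, forall i, A (a i) &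
      v = \sum_i lam i *: a i].

Lemma convex_comb1 A v : A v -> convex_comb A 1 v.
Proof. by exists (fun=> 1), (fun=> v); rewrite !big_ord1 scale1r; split. Qed.

Lemma convex_comb_add A m v w s : convex_comb A m v -> A w -> 0 <= s <= 1 ->
  convex_comb A m.+1 ((1 - s) *: v + s *: w).
Proof.
move=> [lam [a [l0 l1 aA ->]]] Aw /andP[s0 s1].
exists (fun i => oapp (fun j => (1 - s) * lam j) s (unlift ord0 i)),
       (fun i => oapp a w (unlift ord0 i)); split.
- by move=> i; case: unliftP => [j _|_] //=; rewrite mulr_ge0 ?subr_ge0.
- rewrite big_ord_recl unlift_none /= (eq_bigr (fun i => (1 - s) * lam i)).
    by rewrite -mulr_sumr l1 mulr1 addrC subrK.
  by move=> i _; rewrite liftK.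
- by move=> i; case: unliftP => [j _|_] //=.
- rewrite big_ord_recl unlift_none /= addrC scaler_sumr; congr (_ + _).
  by apply: eq_bigr => i _; rewrite liftK /= scalerA.
Qed.

Lemma convex_comb_pad A m m' v : convex_comb A m v -> (m <= m')%N -> convex_comb A m' v.
Proof.
move=> vA; elim: m' => [|m' IH]; first by rewrite leqn0 => /eqP <-.
rewrite leq_eqVlt => /orP[/eqP <-//|/IH{}vA].
(* A point to be added with weight 0; it exists because weights of sum 1 form a nonempty family. *)
have [w Aw] : A !=set0.
  case: vA => lam [a [_ l1 aA _]]; case: m' {IH} lam a l1 aA => [lam a|m' lam a _ aA].
    by rewrite big_ord0 => /esym/eqP; rewrite oner_eq0.
  by exists (a ord0).
have := @convex_comb_add A m' v w 0 vA Aw.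
by rewrite subr0 scale1r scale0r addr0; apply; rewrite lexx ler01.
Qed.

(* Caratheodory's theorem, by the conic version applied to the vectors [(a, 1)]. *)
Lemma caratheodory A m v : convex_comb A m v -> convex_comb A n.+1 v.
Proof.
move=> [lam [a [l0 l1 aA ve]]].
pose M : 'M[R]_(m, n + 1) := \matrix_i row_mx (a i) (const_mx 1).
have [|k [s [mu [mu0 free muM]]]] := @conic_select m _ M (\row_i lam i).
  by move=> i; rewrite mxE.
have lamM : (\row_i lam i) *m M = row_mx v (const_mx 1).
  apply/rowP => j; rewrite mxE; case: (split_ordP j) => i ->.
    rewrite row_mxEl ve summxE; apply: eq_bigr => l _.
    by rewrite [X in X * _]mxE [M _ _]mxE row_mxEl [RHS]mxE.
  rewrite row_mxEr mxE -l1; apply: eq_bigr => l _.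
  by rewrite [X in X * _]mxE [M _ _]mxE row_mxEr mxE mulr1.
have muM' (j : 'I_(n + 1)) : \sum_i mu ord0 i * row_mx (a (s i)) (const_mx 1) ord0 j =
    row_mx v (const_mx 1) ord0 j.
  rewrite -lamM -muM mxE; apply: eq_bigr => i _.
  by rewrite [rowsub _ _ _ _]mxE [M _ _]mxE.
(* At most [n + 1] rows of length [n + 1] are independent. *)
apply: (@convex_comb_pad A k); last first.
  by rewrite -addn1; move: free => /eqP <-; exact: rank_leq_col.
exists (fun i => mu ord0 i), (a \o s); split=> [i||i|]; [exact: ltW| |exact: aA|].
  have := muM' (rshift n ord0); rewrite row_mxEr mxE => <-.
  by apply: eq_bigr => i _; rewrite row_mxEr mxE mulr1.
apply/rowP => j; have := muM' (lshift 1 j); rewrite row_mxEl => <-.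
by rewrite summxE; apply: eq_bigr => i _; rewrite row_mxEl mxE.
Qed.

(* The separating direction is minus a point of almost minimal norm in the convex hull. *)
Lemma separation A (eps B : R) : A !=set0 -> 0 < eps ->
  (forall k, A k -> inner k k <= B) ->
  (forall m k, convex_comb A m k -> eps <= inner k k) ->
  exists d, forall k, A k -> inner k d < 0.
Proof.
move=> [a0 Aa0] eps0 AB hm.
pose E := [set r | exists m k, convex_comb A m k /\ r = inner k k].
have Elb : lbound E eps by move=> _ [m [k [/hm ? ->]]].
have E0 : E !=set0 by exists (inner a0 a0), 1%N, a0; split => //; exact: convex_comb1.
have EI : has_inf E by split => //; exists eps.
set mu := inf E.
have mu0 : 0 < mu by apply: (lt_le_trans eps0); exact: lb_le_inf.
have B0 : 0 <= B := le_trans (inner_ge0 a0) (AB _ Aa0).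
(* The choice of [s] gives [s ^+ 2 * (B + 2 * mu) = s * mu / 4]. If [inner k k0 <= 0], the hull
   point [(1 - s) *: k0 + s *: k] would have squared norm below [mu + s * mu / 2 - 2 * s * mu + s *
   mu / 4 < mu]. *)
pose C := 2 * B + 4 * mu.
have C0 : 0 < C by rewrite /C; lra.
pose s := mu / (2 * C).
have s0 : 0 < s by rewrite divr_gt0 // mulr_gt0.
have sC : s * C = mu / 2 by rewrite /s; field; exact: lt0r_neq0.
have s1 : s <= 1.
  by rewrite ler_pdivrMr ?mulr_gt0 // mul1r /C; lra.
have smu : 0 < s * mu by rewrite mulr_gt0.
have [_ [m [k0 [k0c ->]]] hk0] := @inf_adherent _ _ (s * mu / 2) ltac:(lra) EI.
have k0mu : mu <= inner k0 k0 by apply: ge_inf; [exists eps|exists m, k0].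
exists (- k0) => k Ak; rewrite innerNr oppr_lt0.
have : mu <= inner ((1 - s) *: k0 + s *: k) ((1 - s) *: k0 + s *: k).
  apply: ge_inf; first by exists eps.
  exists m.+1, ((1 - s) *: k0 + s *: k); split => //.
  by apply: convex_comb_add => //; rewrite s1 ltW.
have := inner_ge0 (k + k0); have := AB _ Ak.
rewrite !(innerDl, innerDr, innerZl, innerZr) (innerC k0 k) -/mu in hk0 *.
set p := inner k0 k0 in hk0 k0mu *; set q := inner k k0; set r := inner k k.
move=> rB; have smu2 : s * mu <= mu by rewrite ler_piMl // ltW.
move=> sq hmu; rewrite ltNge; apply/negP => q0.
have h1 : 2 * s * (1 - s) * q <= 0.
  by rewrite mulr_ge0_le0 // mulr_ge0 //; lra.
have h2 : s ^+ 2 * (p + r) <= s ^+ 2 * (B + 2 * mu) by apply: ler_wpM2l; [exact: sqr_ge0|lra].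
have h3 : s ^+ 2 * (B + 2 * mu) = s * mu / 4.
  rewrite expr2 -mulrA; have -> : s * (B + 2 * mu) = mu / 4 by move: sC; rewrite /C; lra.
  by ring.
have h4 : s * mu <= s * p by rewrite ler_pM2l.
have : mu <= p - 2 * (s * p) + s ^+ 2 * (p + r) + 2 * s * (1 - s) * q by move: hmu; lra.
by lra.
Qed.

End ConvexCombinations.

(** * Compact families of convex functions *)

(* [I] carries a bare distance function; only the uniformity it induces matters. *)
Section Families.
Context {R : realType} {n : nat} {I : Type} (dI : I -> I -> R).
Implicit Types (H : I -> 'rV[R]_n -> R) (x y v : 'rV[R]_n).

Definition cover_compact := forall del : I -> R, (forall t, 0 < del t) ->
  exists s : list I, forall t, exists r, List.In r s /\ dI r t < del r.

(** Here [x] varies in the maximum norm, equivalent to [enorm] by [norm_le_enorm] and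
    [enorm_le_norm]. *)
Definition jointly_continuous H := forall t x (eps : R), 0 < eps ->
  exists2 del : R, 0 < del & forall s y, dI t s < del -> `|y - x| < del ->
    `|H s y - H t x| < eps.

Hypothesis Icpt : cover_compact.

(** The least of the finitely many radii of a subcover serves all indices. *)
Lemma cover_uniform (P : I -> R -> Prop) :
  (forall t, exists2 del : R, 0 < del &
    forall s, dI t s < del -> forall r, 0 < r < del -> P s r) ->
  exists2 rho : R, 0 < rho & forall s r, 0 < r < rho -> P s r.
Proof.
move=> loc; have /choice[del hdel] : forall t, exists del : R, 0 < del /\
    forall s, dI t s < del -> forall r, 0 < r < del -> P s r.
  by move=> t; have [del] := loc t; exists del.
have del0 t : 0 < del t by case: (hdel t).
have [s hs] := Icpt del0.
have [rho rho0 hrho] : exists2 rho : R, 0 < rho & forall t, List.In t s -> rho <= del t.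
  elim: s {hs} => [|t s [rho rho0 IH]]; first by exists 1.
  exists (Num.min (del t) rho); first by rewrite lt_min del0.
  by move=> u [<-|/IH]; rewrite ge_min ?lexx // => ->; rewrite orbT.
exists rho => // t r /andP[r0 rr]; have [u [us ut]] := hs t.
by apply: (hdel u).2 => //; rewrite r0 (lt_le_trans rr) ?hrho.
Qed.

(** One parameter is both the radius and, inverted, the bound, which gives the claim the form that
    [cover_uniform] handles. *)
Lemma family_locally_bounded H x : jointly_continuous H ->
  exists2 rho : R, 0 < rho & forall t y, `|y - x| < rho -> `|H t y| <= rho^-1.
Proof.
move=> Hc; have [|rho rho0 h] := @cover_uniform
    (fun t r => forall y, `|y - x| < r -> `|H t y| <= r^-1).
  move=> t; have [del del0 hdel] := Hc t x 1 ltr01.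
  have M0 : 0 < `|H t x| + 1 by rewrite ltr_wpDl.
  exists (Num.min del (`|H t x| + 1)^-1); first by rewrite lt_min del0 invr_gt0.
  move=> s; rewrite lt_min => /andP[ts _] r /andP[r0]; rewrite lt_min => /andP[rd rM] y yx.
  have := hdel s y ts (lt_trans yx rd) => hs.
  apply: (@le_trans _ _ (`|H t x| + 1)).
    by have := ler_normD (H s y - H t x) (H t x); rewrite subrK; lra.
  by rewrite -[leRHS]mul1r ler_pdivlMr // mulrC -ler_pdivlMr // mul1r ltW.
exists (rho / 2); first by rewrite divr_gt0.
by move=> t y; apply: h; rewrite divr_gt0 //=; lra.
Qed.

(** A step of length [rho / 2] along a signed axis changes [H t] by at most [2 / rho], so the
    subgradient inequality bounds each coordinate of [v]. *)
Lemma subdiff_locally_bounded H x : jointly_continuous H ->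
  exists rho B : R, 0 < rho /\
    forall t y v, `|y - x| < rho -> subdiff (H t) y v -> `|v| <= B.
Proof.
move=> Hc; have [rho rho0 h] := family_locally_bounded x Hc.
exists (rho / 2), (4 * rho^-1 / rho); split; first by rewrite divr_gt0.
move=> t y v yx hv; have r20 : 0 < rho / 2 by rewrite divr_gt0.
have yx' : `|y - x| < rho by lra.
have B0 : 0 < rho^-1 by rewrite invr_gt0.
have side (sg : R) i : `|sg| = 1 -> sg * v ord0 i <= 4 * rho^-1 / rho.
  move=> s1; have := hv (y + (rho / 2 * sg) *: delta_mx ord0 i).
  rewrite [y + _ - y]addrC addKr innerZr inner_delta => hy.
  have zx : `|y + (rho / 2 * sg) *: delta_mx ord0 i - x| < rho.
    rewrite addrAC (le_lt_trans (ler_normD _ _)) // normrZ normrM s1 mulr1.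
    have : `|delta_mx ord0 i : 'rV[R]_n| <= 1.
      apply: norm_leP => // j; rewrite mxE; case: (_ && _); rewrite ?normr1 ?normr0 ?lexx ?ler01 //.
    move=> /(ler_wpM2l (ltW r20)); rewrite (gtr0_norm r20); lra.
  have := h t _ zx; have := h t _ yx'; rewrite !ler_norml => /andP[a1 a2] /andP[a3 a4].
  by rewrite ler_pdivlMr //; lra.
apply: norm_leP => [|i]; first by rewrite divr_ge0 ?mulr_ge0 // ltW.
rewrite ler_norml; have := side 1 i (normr1 _); have := side (-1) i (normrN1 _).
by rewrite mul1r mulN1r => ? ?; apply/andP; split; lra.
Qed.

(* Were 0 at positive distance from the convex hull of the active subgradients, a separating
   direction would strictly decrease all the members of the family at once. *)
Lemma approximate_fermat H x (eps : R) :
  (forall t, convex_fun (H t)) -> jointly_continuous H -> (forall t, H t x <= 0) ->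
  ~ (exists y, forall t, H t y < 0) -> 0 < eps ->
  exists2 v, convex_comb [set u | exists2 t, H t x = 0 & subdiff (H t) x u] n.+1 v &
    inner v v < eps.
Proof.
move=> Hconv Hc Hx Hmin eps0; apply: contrapT => far.
set A := [set u | _] in far.
have A0 : A !=set0.
  apply: contrapT => noA; apply: Hmin; exists x => t; rewrite lt_neqAle Hx andbT.
  apply/eqP => tx; have [u ut] := subdiff_nonempty x (Hconv t).
  by apply: noA; exists u, t.
have [rho [B [rho0 hB]]] := subdiff_locally_bounded x Hc.
have [k [t _ kt]|m k km|d dA] := @separation _ _ A eps (n%:R * B ^+ 2) A0 eps0.
- have kB : `|k| <= B by apply: hB kt; rewrite subrr normr0.
  apply: (le_trans (inner_self_le k)); rewrite ler_wpM2l // ler_pXn2r ?nnegrE //.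
  exact: le_trans (normr_ge0 k) kB.
- rewrite leNgt; apply/negP => ke; apply: far; exists k => //; exact: caratheodory km.
(* Inactive members stay negative by continuity. An active one is negative at some [x + s0 *: d],
   since otherwise [subdiff_dir] would give an active subgradient with nonnegative product with [d];
   continuity extends this to nearby indices, convexity to shorter steps. *)
have [|r r0 hr] := @cover_uniform (fun t r => H t (x + r *: d) < 0).
  move=> t; have := Hx t; rewrite le_eqVlt => /predU1P[tx|tx]; last first.
    have [del del0 hdel] := Hc t x (- H t x) ltac:(by rewrite oppr_gt0).
    have D0 : 0 < `|d| + 1 by rewrite ltr_wpDl.
    exists (Num.min del (del / (`|d| + 1))); first by rewrite lt_min del0 divr_gt0.
    move=> s; rewrite lt_min => /andP[ts _] r /andP[r0]; rewrite lt_min => /andP[_ rd].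
    have := hdel s (x + r *: d) ts; rewrite [x + _ - x]addrC addKr normrZ gtr0_norm //.
    have rd' : r * `|d| < del.
      by move: rd; rewrite ltr_pdivlMr //; lra.
    by move=> /(_ rd'); rewrite ltr_norml => /andP[_]; lra.
  have [s0 [s0p hs0]] : exists s0, 0 < s0 /\ H t (x + s0 *: d) < 0.
    apply: contrapT => nos; have [|v vt] := @subdiff_dir _ _ (H t) x d 0 (Hconv t).
      move=> s; rewrite le_eqVlt => /predU1P[<-|s0]; first by rewrite mul0r scale0r !addr0.
      by rewrite mulr0 addr0 tx leNgt; apply/negP => ?; apply: nos; exists s.
    by rewrite leNgt dA //; exists t.
  have [del del0 hdel] := Hc t (x + s0 *: d) (- H t (x + s0 *: d)) ltac:(by rewrite oppr_gt0).
  exists (Num.min del s0); first by rewrite lt_min del0.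
  move=> s; rewrite lt_min => /andP[ts _] r /andP[r0]; rewrite lt_min => /andP[_ rs].
  have := hdel s _ ts; move=> /(_ (x + s0 *: d)); rewrite subrr normr0 => /(_ del0).
  rewrite ltr_norml => /andP[_ hs].
  have l01 : 0 <= r / s0 <= 1.
    by rewrite ler_pdivrMr // mul1r (ltW rs) andbT divr_ge0 // ltW.
  have := Hconv s (x + s0 *: d) x _ l01.
  have -> : (r / s0) *: (x + s0 *: d) + (1 - r / s0) *: x = x + r *: d.
    by apply/rowP => j; rewrite !mxE; field; exact: lt0r_neq0.
  move=> hcv; apply: (le_lt_trans hcv).
  have p0 : 0 < r / s0 by rewrite divr_gt0.
  have a1 : r / s0 * H s (x + s0 *: d) < 0 by rewrite pmulr_rlt0 //; lra.
  have a2 : (1 - r / s0) * H s x <= 0.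
    by rewrite mulr_ge0_le0 // subr_ge0; case/andP: l01.
  by lra.
apply: Hmin; exists (x + (r / 2) *: d) => t; apply: hr; rewrite divr_gt0 //=; lra.
Qed.

End Families.

(** * Limits along an ultrafilter *)

Section UltrafilterLimits.
Context {R : realType} {W : Type} {U : set_system W} {UU : UltraFilter U}.

(** The image of an ultrafilter is an ultrafilter, so in a compact set it converges without
    extraction of a subsequence. *)
Lemma ultra_compact (X : topologicalType) (K : set X) (F : W -> X) :
  compact K -> U (F @^-1` K) -> exists2 l, K l & F w @[w --> U] --> l.
Proof.
rewrite compact_ultra => cK UK.
have FU : UltraFilter (F @ U).
  split=> [|G GF FG]; first exact: fmap_proper_filter.
  rewrite eqEsubset; split=> // A GA; have [//|UA] := in_ultra_setVsetC (F @^-1` A) UU.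
  have : G (A `&` ~` A) by apply: filterI => //; exact: FG.
  by rewrite setICr => /filter_ex[].
by have [l [Kl Fl]] := cK _ FU UK; exists l.
Qed.

Lemma ultra_bounded_rV n (F : W -> 'rV[R]_n) (B : R) :
  U [set w | `|F w| <= B] -> exists l : 'rV[R]_n, F w @[w --> U] --> l.
Proof.
move=> FB; have [|l _ Fl] := @ultra_compact _ _ F
    (@rV_compact R n (fun=> `[- B, B]%classic) (fun=> @segment_compact R _ _)).
  apply: filterS FB => w /= wB i; rewrite in_itv /= -ler_norml.
  exact: le_trans (coord_norm_le _ _) wB.
by exists l.
Qed.

(** Otherwise each index has a ball that [o] avoids along [U]; finitely many such balls cover [I], a
    contradiction. *)
Lemma ultra_index I (dI : I -> I -> R) (o : W -> I) : cover_compact dI ->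
  exists t, forall eps : R, 0 < eps -> U [set w | dI t (o w) < eps].
Proof.
move=> Icpt; apply: contrapT => no.
have /choice[del hdel] : forall t, exists eps : R, 0 < eps /\ ~ U [set w | dI t (o w) < eps].
  move=> t; apply: contrapT => h; apply: no; exists t => eps eps0.
  by apply: contrapT => ?; apply: h; exists eps.
have [s hs] := Icpt del (fun t => (hdel t).1).
have : U [set w | forall r, List.In r s -> ~ dI r (o w) < del r].
  elim: s {hs} => [|r s IH]; first by apply: filterE => w r [].
  have [/(hdel r).2//|Ur] := in_ultra_setVsetC [set w | dI r (o w) < del r] UU.
  apply: filterS (filterI Ur IH) => w [/= wr ws] r' [<-//|]; exact: ws.
move=> /filter_ex[w hw]; have [r [rs wr]] := hs (o w).
exact: hw wr.
Qed.

Lemma cvg_sumr (V : normedModType R) (J : Type) (r : seq J) (P : pred J)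
    (F : J -> W -> V) (l : J -> V) :
  (forall j, P j -> F j w @[w --> U] --> l j) ->
  \sum_(j <- r | P j) F j w @[w --> U] --> \sum_(j <- r | P j) l j.
Proof.
move=> Fl; elim: r => [|j r IH].
  by rewrite big_nil; under eq_fun do rewrite big_nil; exact: cvg_cst.
rewrite big_cons; under eq_fun do rewrite big_cons.
by case: ifP => // Pj; apply: cvgD => //; exact: Fl.
Qed.

Lemma cvg_prodr (J : Type) (r : seq J) (F : J -> W -> R) (l : J -> R) :
  (forall j, F j w @[w --> U] --> l j) ->
  \prod_(j <- r) F j w @[w --> U] --> \prod_(j <- r) l j.
Proof.
move=> Fl; elim: r => [|j r IH].
  by rewrite big_nil; under eq_fun do rewrite big_nil; exact: cvg_cst.
rewrite big_cons; under eq_fun do rewrite big_cons.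
by apply: cvgM => //; exact: Fl.
Qed.

Lemma cvg_coord n (F : W -> 'rV[R]_n) (l : 'rV[R]_n) i :
  F w @[w --> U] --> l -> F w ord0 i @[w --> U] --> l ord0 i.
Proof.
move=> /cvgrPdist_lt Fl; apply/cvgrPdist_lt => eps eps0.
apply: filterS (Fl _ eps0) => w; apply: le_lt_trans.
by have := coord_norm_le (l - F w) i; rewrite !mxE.
Qed.

Lemma cvg_inner n (F G : W -> 'rV[R]_n) (k l : 'rV[R]_n) :
  F w @[w --> U] --> k -> G w @[w --> U] --> l ->
  inner (F w) (G w) @[w --> U] --> inner k l.
Proof. by move=> Fk Gl; apply: cvg_sumr => i _; apply: cvgM; exact: cvg_coord. Qed.

Lemma cvg_det n (F : W -> 'M[R]_n) (A : 'M[R]_n) :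
  (forall i j, F w i j @[w --> U] --> A i j) -> \det (F w) @[w --> U] --> \det A.
Proof.
move=> FA; apply: cvg_sumr => s _; apply: cvgM; first exact: cvg_cst.
by apply: cvg_prodr => i; exact: FA.
Qed.

Lemma cvg_cofactor n (F : W -> 'M[R]_n) (A : 'M[R]_n) i j :
  (forall i j, F w i j @[w --> U] --> A i j) ->
  cofactor (F w) i j @[w --> U] --> cofactor A i j.
Proof.
move=> FA; apply: cvgM; first exact: cvg_cst.
by apply: cvg_det => k l; rewrite !mxE; under eq_fun do rewrite !mxE; exact: FA.
Qed.

(** By Cramer's formula, the entries of the inverse are cofactors divided by a determinant whose
    limit is nonzero. *)
Lemma cvg_solve n (F : W -> 'M[R]_n) (A : 'M[R]_n) (p : W -> 'rV[R]_n) (q : 'rV[R]_n) :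
  A \in unitmx -> (forall i j, F w i j @[w --> U] --> A i j) -> p w @[w --> U] --> q ->
  U [set w | F w \in unitmx] /\
  forall j, (p w *m invmx (F w)) ord0 j @[w --> U] --> (q *m invmx A) ord0 j.
Proof.
move=> Aunit FA pq; have dA := cvg_det FA.
have d0 : \det A != 0 by rewrite -unitfE -unitmxE.
have Fu : U [set w | F w \in unitmx].
  by apply: filterS (cvgr_neq0 _ dA d0) => w; rewrite /= unitmxE unitfE.
split=> // j.
have E (B : 'M[R]_n) (v : 'rV[R]_n) : B \in unitmx ->
    (v *m invmx B) ord0 j = \sum_i v ord0 i * ((\det B)^-1 * cofactor B j i).
  by move=> Bu; rewrite mxE; apply: eq_bigr => i _; rewrite /invmx Bu !mxE.
rewrite E //; apply: (@cvg_trans _ ((fun w => \sum_i p w ord0 i *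
    ((\det (F w))^-1 * cofactor (F w) j i)) @ U)).
  by apply: near_eq_cvg; apply: filterS Fu => w /E ->.
apply: cvg_sumr => i _; apply: cvgM; first exact: cvg_coord.
by apply: cvgM; [exact: cvgV|exact: cvg_cofactor].
Qed.

Lemma cvg_le (F G : W -> R) (k l : R) : F w @[w --> U] --> k -> G w @[w --> U] --> l ->
  U [set w | F w <= G w] -> k <= l.
Proof.
move=> Fk Gl FG; rewrite leNgt; apply/negP => lk.
have Fm : U [set w | (k + l) / 2 < F w] by apply: (cvgr_gt _ Fk); lra.
have Gm : U [set w | G w < (k + l) / 2] by apply: (cvgr_lt _ Gl); lra.
have /filter_ex[w [[/= ? ?] /= ?]] : U ([set w | (k + l) / 2 < F w] `&`
    [set w | G w < (k + l) / 2] `&` [set w | F w <= G w]).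
  by apply: filterI => //; exact: filterI.
by lra.
Qed.

Lemma cvg_family n I (dI : I -> I -> R) (H : I -> 'rV[R]_n -> R) o t y (z : 'rV[R]_n) :
  jointly_continuous dI H -> (forall eps : R, 0 < eps -> U [set w | dI t (o w) < eps]) ->
  y w @[w --> U] --> z -> H (o w) (y w) @[w --> U] --> H t z.
Proof.
move=> Hc ot /cvgrPdist_lt yz; apply/cvgrPdist_lt => eps eps0.
have [del del0 hdel] := Hc t z eps eps0.
apply: filterS (filterI (ot _ del0) (yz _ del0)) => w [/= wt].
by rewrite distrC => wy; rewrite distrC; exact: hdel.
Qed.

Lemma subdiff_closed n I (dI : I -> I -> R) (H : I -> 'rV[R]_n -> R) o t x v (x0 v0 : 'rV[R]_n) :
  jointly_continuous dI H -> (forall eps : R, 0 < eps -> U [set w | dI t (o w) < eps]) ->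
  x w @[w --> U] --> x0 -> v w @[w --> U] --> v0 ->
  U [set w | subdiff (H (o w)) (x w) (v w)] -> subdiff (H t) x0 v0.
Proof.
move=> Hc ot xx vv sub y.
apply: (@cvg_le (fun w => H (o w) (x w) + inner (v w) (y - x w)) (fun w => H (o w) y)).
- apply: cvgD; first exact: cvg_family Hc ot xx.
  by apply: cvg_inner => //; apply: cvgB => //; exact: cvg_cst.
- by apply: (@cvg_family _ _ dI H o t (fun=> y) y) => //; exact: cvg_cst.
- by apply: filterS sub => w; exact.
Qed.

End UltrafilterLimits.

(** * Karush-Kuhn-Tucker conditions *)

Section Problem.
Context {R : realType} {n : nat} {Z : Type} (dZ : Z -> Z -> R) (T : set Z).
Variables (f : 'rV[R]_n -> R) (g : sig T -> 'rV[R]_n -> R).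
Hypothesis dZ_metric : is_metric dZ.
Hypothesis Tcpt : compact_in dZ T.
Hypothesis f_convex : convex_fun f.
Hypothesis g_convex : forall t, convex_fun (g t).
Hypothesis g_cont : joint_cont dZ g.

Lemma compact_subcover (del : sig T -> R) : (forall t, 0 < del t) ->
  exists s : list (sig T), forall t : sig T, exists r, List.In r s /\
    dZ (proj1_sig r) (proj1_sig t) < del r.
Proof.
have [d0 [d1 [dC dT]]] := dZ_metric.
move=> del0; have [t z zt|z Tz|s hs] :=
    Tcpt (U := fun t => [set z | dZ (proj1_sig t) z < del t]).
- exists (del t - dZ (proj1_sig t) z); first by rewrite subr_gt0.
  by move=> w zw /=; have := dT (proj1_sig t) z w; move: zt zw => /=; lra.
- by exists (exist _ z Tz) => /=; rewrite (d1 z z).2.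
- by exists s => t; exact: hs (proj2_sig t).
Qed.

Lemma cont_on_bounded (b : sig T -> R) : cont_on dZ b -> exists M, forall t, `|b t| <= M.
Proof.
move=> bc; have /choice[del hdel] : forall t, exists del : R, 0 < del /\
    forall s, dZ (proj1_sig t) (proj1_sig s) < del -> `|b s - b t| < 1.
  by move=> t; have [del] := bc t 1 ltr01; exists del.
have [s hs] := compact_subcover (fun t => (hdel t).1).
have [M hM] : exists M, forall t, List.In t s -> `|b t| <= M.
  elim: s {hs} => [|r s [M hM]]; first by exists 0.
  exists (Num.max `|b r| M) => t [<-|/hM]; rewrite le_max ?lexx // => ->.
  by rewrite orbT.
exists (M + 1) => t; have [r [/hM rs /(hdel r).2 tr]] := hs t.
by have := ler_normD (b t - b r) (b r); rewrite subrK; lra.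
Qed.

Lemma cont_onB (b b' : sig T -> R) :
  cont_on dZ b -> cont_on dZ b' -> cont_on dZ (fun t => b t - b' t).
Proof.
move=> bc bc' t eps eps0.
have [del del0 h] := bc t (eps / 2) ltac:(lra).
have [del' del'0 h'] := bc' t (eps / 2) ltac:(lra).
exists (Num.min del del'); first by rewrite lt_min del0.
move=> s; rewrite lt_min => /andP[/h hs /h' hs'].
have -> : b s - b' s - (b t - b' t) = (b s - b t) - (b' s - b' t) by ring.
by apply: (le_lt_trans (ler_normB _ _)); lra.
Qed.

Lemma le_supnorm (b : sig T -> R) t : cont_on dZ b -> `|b t| <= supnorm b.
Proof.
move=> /cont_on_bounded[M hM]; apply: ub_le_sup; last by exists t.
by exists M => _ [s _ <-].
Qed.

(** [None] indexes the objective. It lies at distance 1 from all constraints, so a converging index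
    eventually keeps its kind. *)
Definition option_dist (s t : option (sig T)) : R :=
  match s, t with
  | None, None => 0
  | Some s, Some t => dZ (proj1_sig s) (proj1_sig t)
  | _, _ => 1
  end.

(** When [h] is the objective minus its value at an optimal solution, no point makes all members
    negative. *)
Definition problem_family (h : 'rV[R]_n -> R) (b : sig T -> R) (o : option (sig T)) :=
  if o is Some t then fun y => g t y - b t else h.

Lemma option_dist_compact : cover_compact option_dist.
Proof.
move=> del del0; have [s hs] := compact_subcover (fun t => del0 (Some t)).
exists (None :: List.map Some s) => -[t|]; last by exists None; split; [left|exact: del0].
have [r [rs rt]] := hs t; exists (Some r); split=> //; right; exact: List.in_map.
Qed.

Lemma problem_family_cont h b : convex_fun h -> cont_on dZ b ->
  jointly_continuous option_dist (problem_family h b).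
Proof.
move=> hc bc [t|] x eps eps0.
  have eps20 : 0 < eps / 2 by lra.
  have [del del0 hdel] := g_cont t x eps20.
  have [del' del'0 hdel'] := bc t _ eps20.
  have N0 : 0 < n.+1%:R :> R by rewrite ltr0n.
  (* The factor [n.+1] converts between the norms; the bound 1 keeps [None] away. *)
  exists (Num.min (Num.min del del' ) (Num.min (del / n.+1%:R) 1)).
    by rewrite !lt_min del0 del'0 divr_gt0 //= ltr01.
  move=> [s|] y; last by rewrite /= !lt_min ltxx !andbF.
  rewrite /= !lt_min => /andP[/andP[/hdel hs /hdel' hs'] _] /andP[_ /andP[yx _]].
  have {}hs : `|g s y - g t x| < eps / 2.
    apply: hs; apply: (le_lt_trans (enorm_le_norm _)).
    by rewrite mulrC -ltr_pdivlMr.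
  have -> : g s y - b s - (g t x - b t) = (g s y - g t x) - (b s - b t) by ring.
  by apply: (le_lt_trans (ler_normB _ _)); lra.
have [del del0 hdel] := convex_continuous x hc eps0.
exists (Num.min del 1); first by rewrite lt_min del0 ltr01.
move=> [s|] y; rewrite /= !lt_min ?ltxx ?andbF // => _ /andP[yx _]; exact: hdel.
Qed.

Lemma problem_family_convex h b o : convex_fun h -> convex_fun (problem_family h b o).
Proof.
move=> hc; case: o => [t|] //= x y l hl; have := g_convex t x y hl; lra.
Qed.

(** This is of Fritz John type: the objective may have weight 0. The subgradients ignore the
    constants [b0 t], so a family independent of [b] can be used in the limit. *)
Lemma approximate_kkt c b b0 x eps : cont_on dZ b -> Sol f g (c, b) x -> 0 < eps ->
  exists (o : 'I_n.+1 -> option (sig T)) (k : 'I_n.+1 -> 'rV[R]_n) (lam : 'I_n.+1 -> R),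
  [/\ forall i, 0 <= lam i, \sum_i lam i = 1,
      forall i, subdiff (problem_family f b0 (o i)) x (k i),
      forall i t, o i = Some t -> g t x = b t &
      inner (\sum_i lam i *: (k i + if o i is Some _ then 0 else c))
            (\sum_i lam i *: (k i + if o i is Some _ then 0 else c)) < eps].
Proof.
move=> bc [/= xf xmin] eps0.
pose h y := f y + inner c y - (f x + inner c x).
have hc : convex_fun h.
  move=> y z l hl; have := f_convex y z hl; rewrite /h innerDr !innerZr; lra.
have Hx o : problem_family h b o x <= 0.
  by case: o => [t|] /=; rewrite ?subr_le0 ?xf // /h subrr.
have [|v [lam [a [l0 l1 aA ->]]] hv] := approximate_fermat option_dist_compact
    (fun o => problem_family_convex b o hc) (problem_family_cont hc bc) Hx _ eps0.
  move=> [y hy]; have := hy None; rewrite /= /h ltNge subr_ge0 xmin // => t.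
  by have := hy (Some t); rewrite /= subr_lt0 => /ltW.
have /choice[ix hix] : forall i, exists t,
    problem_family h b t x = 0 /\ subdiff (problem_family h b t) x (a i).
  by move=> i; have [t] := aA i; exists t.
(* Removing the linear term [c] turns subgradients of [h] into subgradients of [f]. *)
exists ix, (fun i => a i - if ix i is Some _ then 0 else c), lam; split=> //.
- move=> i; have [_] := hix i; case: (ix i) => [t|] /= sub y; have := sub y.
    by rewrite subr0; lra.
  by rewrite /h !(innerDl, innerNl, innerDr, innerNr); lra.
- by move=> i t oi; have [] := hix i; rewrite oi /= => /eqP; rewrite subr_eq0 => /eqP.
- by under eq_bigr do rewrite subrK.
Qed.

(** For feasible [y], each active subgradient has a nonpositive product with [y - x], hence [u + c]
    a nonnegative one. *)
Lemma kkt_sufficient c b x k u (v : 'I_k -> 'rV[R]_n) (mu : 'I_k -> R) :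
  feasible g b x -> subdiff f x u ->
  (forall j, exists2 t, g t x = b t & subdiff (g t) x (v j)) ->
  (forall j, 0 <= mu j) -> - (u + c) = \sum_j mu j *: v j -> Sol f g (c, b) x.
Proof.
move=> xf fu gv mu0 uv; split=> //= y yf.
have : inner (- (u + c)) (y - x) <= 0.
  rewrite uv inner_suml; apply: sumr_le0 => j _; rewrite innerZl mulr_ge0_le0 //.
  by have [t tx /(_ y)] := gv j; have := yf t; lra.
have := fu y; rewrite innerNl !(innerDl, innerDr, innerNr); lra.
Qed.

End Problem.

(** * Exact multipliers in the limit *)

Section LimitMultipliers.
Context {R : realType} {n : nat} {Z : Type} (T : set Z).
Variables (f : 'rV[R]_n -> R) (g : sig T -> 'rV[R]_n -> R).
Variables (cbar : 'rV[R]_n) (bbar : sig T -> R) (xbar : 'rV[R]_n).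
Hypothesis enc : ENC f g cbar bbar xbar.
Context {N : nat}.
Variables (o : 'I_N -> option (sig T)) (k : 'I_N -> 'rV[R]_n) (lam : 'I_N -> R).
Hypothesis lam0 : forall i, 0 <= lam i.
Hypothesis lam1 : \sum_i lam i = 1.
Hypothesis sub : forall i, subdiff (problem_family g f bbar (o i)) xbar (k i).
Hypothesis act : forall i t, o i = Some t -> g t xbar = bbar t.
Hypothesis stat : \sum_i lam i *: (k i + if o i is Some _ then 0 else cbar) = 0.

(** Several indices may be [None]; their total weight is the Fritz John multiplier of the
    objective. *)
Definition objective_mass : R := \sum_(i | ~~ o i) lam i.

(** Subgradients of active constraints have negative products with [xh - xbar], for [xh] a Slater
    point. Were the objective weightless, pairing [stat] with this vector would force all weights to
    vanish. *)
Lemma objective_mass_gt0 : 0 < objective_mass.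
Proof.
have [[xh hxh] _] := enc.
rewrite lt0r sumr_ge0 // andbT; apply/eqP => m0.
have lN i : ~~ o i -> lam i = 0.
  move/eqP: m0; rewrite psumr_eq0 // => /allP h oi.
  by have := h i (mem_index_enum i); rewrite oi => /eqP.
have neg i : o i -> inner (k i) (xh - xbar) < 0.
  have := sub i xh; have := @act i; case: (o i) => [t|] //= /(_ _ erefl) -> ht _.
  have := hxh t; lra.
have : \sum_i - (lam i * inner (k i) (xh - xbar)) = 0.
  have := congr1 (fun v => inner v (xh - xbar)) stat.
  rewrite /= inner_suml inner0l sumrN => h; apply/eqP; rewrite oppr_eq0; apply/eqP.
  rewrite -[RHS]h; apply: eq_bigr => i _; rewrite innerZl.
  by have := @lN i; case: (o i) => [t|/(_ isT) ->] //; rewrite ?addr0 ?mul0r.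
move/eqP; rewrite psumr_eq0 => [/allP h|i _]; last first.
  rewrite oppr_ge0; have [oi|/lN ->] := boolP (isSome (o i)); last by rewrite mul0r.
  by rewrite mulr_ge0_le0 // ltW // neg.
move/eqP: lam1; rewrite big1 => [|i _]; first by rewrite eq_sym oner_eq0.
have [oi|/lN //] := boolP (isSome (o i)).
have := h i (mem_index_enum i); rewrite oppr_eq0 mulf_eq0 => /orP[/eqP //|/eqP h0].
by have := neg i oi; rewrite h0 ltxx.
Qed.

(* ENC forces the conic Caratheodory reduction of the limiting stationarity condition to
   retain exactly [n] constraints, with positive multipliers and independent gradients. *)
Lemma enc_multipliers : exists (s : 'I_n -> 'I_N) (mu : 'rV[R]_n),
  [/\ forall j, isSome (o (s j)), forall j, 0 < mu ord0 j,
      \matrix_j k (s j) \in unitmx &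
      - (\sum_(i | ~~ o i) (lam i / objective_mass) *: k i + cbar) = mu *m \matrix_j k (s j)].
Proof.
have m0 := objective_mass_gt0; have mN0 := lt0r_neq0 m0.
pose S := [pred i | isSome (o i)]; pose e := @enum_val _ S.
pose A : 'M[R]_(#|S|, n) := \matrix_j k (e j).
set ubar := \sum_(i | _) _.
(* Stationarity divided by the mass of the objective; the weights in [ubar] then sum to 1, so [ubar]
   is a subgradient of [f]. *)
have eq_u : - (ubar + cbar) = (\row_j (lam (e j) / objective_mass)) *m A.
  apply/(scalerI mN0)/eqP; rewrite -subr_eq0 scalerN -opprD oppr_eq0; apply/eqP.
  rewrite -[RHS]stat (bigID (fun i => isSome (o i))) /= [LHS]addrC; congr (_ + _); last first.
    rewrite scalerDr /ubar scaler_sumr {2}/objective_mass scaler_suml -big_split.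
    by apply: eq_bigr => i; case: (o i) => //= _; rewrite scalerDr scalerA mulrCA divff ?mulr1.
  have -> : (\row_j (lam (e j) / objective_mass)) *m A =
      \sum_(j < #|S|) (lam (e j) / objective_mass) *: k (e j).
    apply/rowP => l; rewrite mxE summxE; apply: eq_bigr => j _; rewrite !mxE //.
  rewrite -(big_enum_val (fun i => (lam i / objective_mass) *: k i)) scaler_sumr.
  apply: eq_bigr => i; rewrite inE; case: (o i) => //= t _.
  by rewrite addr0 scalerA mulrCA divff ?mulr1.
have [|r [s [mu [mu0 free muA]]]] := @conic_select _ _ _ A (\row_j (lam (e j) / objective_mass)).
  by move=> i; rewrite mxE divr_ge0 // ltW.
have eo j : isSome (o (e j)) by exact: (enum_valP j).
have /choice[t ht] : forall j, exists t, o (e (s j)) = Some t.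
  by move=> j; have := eo (s j); case: (o _) => // t; exists t.
have rn : (r <= n)%N by move/eqP: free => <-; exact: rank_leq_col.
(* With [r < n], the selected constraints would form a set [D] excluded by ENC. *)
have {}rn : r = n.
  apply/eqP; rewrite eqn_leq rn leqNgt; apply/negP => lt_rn.
  have [_ []] := enc; exists [seq t j | j <- enum 'I_r].
  have inD (l : seq 'I_r) y : List.In y [seq t j | j <- l] -> exists j, y = t j.
    by elim: l => //= j l IH [<-|/IH //]; exists j.
  have Din (l : seq 'I_r) j : j \in l -> List.In (t j) [seq t j | j <- l].
    elim: l => //= j' l IH; rewrite inE => /predU1P[<-|/IH]; [by left|by right].
  split; first by rewrite size_map size_enum_ord.
  split; first by move=> y /inD[j ->]; exact: act (ht j).
  exists (- (ubar + cbar)); split.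
    exists ubar => //; apply: subdiff_convex => [i _||i oi].
    - by rewrite divr_ge0 // ltW.
    - by rewrite -mulr_suml divff.
    - by have := @sub i; case: (o i) oi.
  exists r, (fun j => mu ord0 j), (fun j => k (e (s j))); split=> [j|]; first exact: ltW.
  split=> [j|].
    exists (t j); first by apply: Din; rewrite mem_enum.
    move=> y; have := @sub (e (s j)) y; rewrite ht /=; lra.
  rewrite eq_u -muA; apply/rowP => l; rewrite mxE summxE; apply: eq_bigr => j _.
  by rewrite !mxE.
subst r; have VA : \matrix_j k (e (s j)) = rowsub s A.
  by apply/matrixP => i j; rewrite !mxE.
exists (e \o s), mu; split=> //=; first by rewrite VA -row_free_unit.
by rewrite eq_u -muA VA.
Qed.

End LimitMultipliers.

(** * Stability of optimal solutions *)

Section Stability.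
Context {R : realType} {n : nat} {Z : Type} (dZ : Z -> Z -> R) (T : set Z).
Variables (f : 'rV[R]_n -> R) (g : sig T -> 'rV[R]_n -> R).
Variables (cbar : 'rV[R]_n) (bbar : sig T -> R) (xbar : 'rV[R]_n).
Hypothesis dZ_metric : is_metric dZ.
Hypothesis Tcpt : compact_in dZ T.
Hypothesis f_convex : convex_fun f.
Hypothesis g_convex : forall t, convex_fun (g t).
Hypothesis g_cont : joint_cont dZ g.
Hypothesis bbar_cont : cont_on dZ bbar.
Hypothesis enc : ENC f g cbar bbar xbar.

Definition kkt_residual (N : nat) (o : 'I_N -> option (sig T)) (k : 'I_N -> 'rV[R]_n)
    (lam : 'I_N -> R) (c : 'rV[R]_n) :=
  \sum_i lam i *: (k i + if o i is Some _ then 0 else c).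

(** Before the limit, the multipliers at hand are only approximate and belong to the cost [c w].
    They are replaced by the exact solution of the square system for [cbar] given by the [n]
    constraints selected in the limit. *)
Lemma kkt_limit (W : Type) (U : set_system W) (UU : UltraFilter U) (N : nat)
    (c x : W -> 'rV[R]_n) (b : W -> sig T -> R) (o : 'I_N -> W -> option (sig T))
    (k : 'I_N -> W -> 'rV[R]_n) (lam : 'I_N -> W -> R) :
  c w @[w --> U] --> cbar -> x w @[w --> U] --> xbar ->
  (forall eps : R, 0 < eps -> U [set w | forall t, `|b w t - bbar t| < eps]) ->
  U [set w | feasible g (b w) (x w)] ->
  U [set w | [/\ forall i, 0 <= lam i w, \sum_i lam i w = 1,
      forall i, subdiff (problem_family g f bbar (o i w)) (x w) (k i w) &
      forall i t, o i w = Some t -> g t (x w) = b w t]] ->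
  (forall eps : R, 0 < eps -> U [set w |
    inner (kkt_residual (o^~ w) (k^~ w) (lam^~ w) (c w))
      (kkt_residual (o^~ w) (k^~ w) (lam^~ w) (c w))
    < eps]) ->
  U [set w | Sol f g (cbar, b w) (x w)].
Proof.
move=> cc xx bb feas kkt small.
have Fc := problem_family_cont g_cont f_convex bbar_cont.
have [rho [B [rho0 hB]]] :=
  subdiff_locally_bounded (option_dist_compact dZ_metric Tcpt) xbar Fc.
have /choice[kl kkl] : forall i, exists l : 'rV[R]_n, k i w @[w --> U] --> l.
  move=> i; apply: (@ultra_bounded_rV _ _ _ _ _ _ B).
  move/cvgrPdist_lt: xx => /(_ _ rho0) xx'.
  apply: filterS (filterI kkt xx') => w [[_ _ ks _] /= wx].
  by apply: hB (ks i); rewrite distrC.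
have /choice[ll lll] : forall i, exists l : R, lam i w @[w --> U] --> l.
  move=> i; have [|l _ Fl] := ultra_compact (F := lam i) (@segment_compact R 0 1).
    apply: filterS kkt => w [l0 l1 _ _]; rewrite /= in_itv /= l0 -l1.
    by rewrite (bigD1 i) //= lerDl sumr_ge0.
  by exists l.
have /choice[tau otau] : forall i, exists t, forall eps : R, 0 < eps ->
    U [set w | option_dist dZ t (o i w) < eps].
  by move=> i; apply: ultra_index; exact: option_dist_compact.
have tags : U [set w | forall i, isSome (o i w) = isSome (tau i)].
  apply: filter_forall => i; apply: filterS (otau i 1 ltr01) => w /=.
  by case: (tau i) (o i w) => [t|] [s|] //=; rewrite ltxx.
have ll0 i : 0 <= ll i.
  by apply: (cvg_le (cvg_cst 0) (lll i)); apply: filterS kkt => w [h _ _ _]; exact: h.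
have suml : \sum_i lam i w @[w --> U] --> \sum_i ll i by apply: cvg_sumr => i _; exact: lll.
have ll1 : \sum_i ll i = 1.
  have le1 : \sum_i ll i <= 1.
    by apply: (cvg_le suml (cvg_cst (1 : R))); apply: filterS kkt => w [_ /= -> _ _].
  have ge1 : 1 <= \sum_i ll i.
    by apply: (cvg_le (cvg_cst (1 : R)) suml); apply: filterS kkt => w [_ /= -> _ _].
  by apply/le_anti; rewrite le1 ge1.
have sub i : subdiff (problem_family g f bbar (tau i)) xbar (kl i).
  by apply: (subdiff_closed Fc (otau i) xx (kkl i)); apply: filterS kkt => w [_ _ h _]; exact: h.
have act i t : tau i = Some t -> g t xbar = bbar t.
  move=> ti; suff small_diff (eps : R) : 0 < eps -> `|g t xbar - bbar t| <= eps.
    apply/eqP; rewrite -subr_eq0 -normr_le0; apply/ler_addgt0Pr => eps eps0.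
    by rewrite add0r small_diff.
  move=> eps0.
  (* Before the limit, the constraint is active for [b w], so its value relative to [bbar] is a
     difference [b w s - bbar s], which tends to 0. *)
  have lim : `|problem_family g f bbar (o i w) (x w)| @[w --> U] --> `|g t xbar - bbar t|.
    apply: cvg_norm; rewrite -[g t xbar - bbar t]/(problem_family g f bbar (Some t) xbar) -ti.
    exact: cvg_family Fc (otau i) xx.
  apply: (cvg_le lim (cvg_cst eps)).
  apply: filterS (filterI (otau i 1 ltr01) (filterI kkt (bb eps eps0))) => w [/=].
  rewrite ti => oi [[_ _ _ /(_ i) wact] wb].
  case: (o i w) oi wact => [s|] /=; last by rewrite ltxx.
  by move=> _ /(_ _ erefl) ->; exact: ltW.
have stat : kkt_residual tau kl ll cbar = 0.
  (* The residual with the kinds of its indices frozen; it agrees with the true one along [U]. *)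
  pose S w := \sum_i lam i w *: (k i w + if tau i is Some _ then 0 else c w).
  have Slim : S w @[w --> U] --> kkt_residual tau kl ll cbar.
    apply: cvg_sumr => i _; apply: cvgZ => //; apply: cvgD => //.
    by case: (tau i) => [t|//]; exact: cvg_cst.
  apply: inner_eq0; apply/le_anti; rewrite inner_ge0 andbT; apply/ler_addgt0Pr => eps eps0.
  rewrite add0r; apply: (cvg_le (cvg_inner Slim Slim) (cvg_cst eps)).
  apply: filterS (filterI tags (small _ eps0)) => w [/= wtags /ltW].
  suff -> : kkt_residual (o^~ w) (k^~ w) (lam^~ w) (c w) = S w by [].
  by apply: eq_bigr => i _; have := wtags i; case: (o i w) (tau i) => [?|] [?|].
have [s [mu [ss mu0 Vu eq_mu]]] := enc_multipliers enc ll0 ll1 sub act stat.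
have mass0 := objective_mass_gt0 enc ll0 ll1 sub act stat.
set mass := objective_mass tau ll in eq_mu mass0.
(* The limiting weights are kept, so that [u w] is an exact convex combination of subgradients of
   [f] at [x w]. *)
pose u w := \sum_(i | ~~ tau i) (ll i / mass) *: k i w.
pose V w : 'M[R]_n := \matrix_j k (s j) w.
have plim : - (u w + cbar) @[w --> U] --> mu *m \matrix_j kl (s j).
  rewrite -eq_mu; apply: cvgN; apply: cvgD; last exact: cvg_cst.
  by apply: cvg_sumr => i _; apply: cvgZ => //; exact: cvg_cst.
have Vlim i j : V w i j @[w --> U] --> (\matrix_j kl (s j)) i j.
  rewrite mxE; under eq_fun do rewrite mxE; exact: cvg_coord.
have [VU nulim] := cvg_solve Vu Vlim plim.
(* The solutions converge to [mu], whose entries are positive. *)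
have nupos : U [set w | forall j, 0 < (- (u w + cbar) *m invmx (V w)) ord0 j].
  apply: filter_forall => j; apply: (cvgr_gt _ (nulim j)).
  by rewrite mulmxK.
apply: filterS (filterI (filterI VU nupos) (filterI tags (filterI feas kkt))) => w.
move=> [[/= wVU wnu] [wtags [wfeas [_ _ wsub wact]]]].
apply: (@kkt_sufficient _ _ _ _ f g cbar (b w) (x w) n (u w) (fun j => k (s j) w)
  (fun j => (- (u w + cbar) *m invmx (V w)) ord0 j)) => //.
- apply: subdiff_convex => [i _||i ti].
  + by rewrite divr_ge0 // ltW.
  + by rewrite -mulr_suml divff // lt0r_neq0.
  + by have := wsub i; have := wtags i; case: (o i w) (tau i) ti => [?|] [?|].
- move=> j; have := wtags (s j); have := wsub (s j); have := wact (s j).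
  rewrite ss; case: (o (s j) w) => // t /(_ _ erefl) tx tsub _; exists t => // y.
  by have := tsub y; rewrite /=; lra.
- by move=> j; exact: ltW.
- rewrite -[LHS](mulmxKV wVU); apply/rowP => l; rewrite mxE summxE.
  by apply: eq_bigr => j _; rewrite [V w j l]mxE [RHS]mxE.
Qed.

(** The points on which the ultrafilter lives: a parameter, a solution and its approximate
    multipliers. *)
Record kkt_data := KktData {
  kd_c : 'rV[R]_n; kd_b : sig T -> R; kd_x : 'rV[R]_n;
  kd_o : 'I_n.+1 -> option (sig T); kd_k : 'I_n.+1 -> 'rV[R]_n; kd_lam : 'I_n.+1 -> R }.

Lemma optimal_unperturbed_cost : exists2 del : R, 0 < del & forall c b x,
  cont_on dZ b -> enorm (c - cbar) < del -> (forall t, `|b t - bbar t| < del) ->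
  enorm (x - xbar) < del -> Sol f g (c, b) x -> Sol f g (cbar, b) x.
Proof.
apply: contrapT => no.
pose P (del : R) := [set w : kkt_data |
  [/\ `|kd_c w - cbar| < del, `|kd_x w - xbar| < del, forall t, `|kd_b w t - bbar t| < del &
      inner (kkt_residual (kd_o w) (kd_k w) (kd_lam w) (kd_c w))
            (kkt_residual (kd_o w) (kd_k w) (kd_lam w) (kd_c w)) < del] /\
  [/\ forall i, 0 <= kd_lam w i, \sum_i kd_lam w i = 1,
      forall i, subdiff (problem_family g f bbar (kd_o w i)) (kd_x w) (kd_k w i) &
      forall i t, kd_o w i = Some t -> g t (kd_x w) = kd_b w t] /\
  feasible g (kd_b w) (kd_x w) /\ ~ Sol f g (cbar, kd_b w) (kd_x w)].
have Pne del : 0 < del -> P del !=set0.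
  move=> del0; apply: contrapT => empty; apply: no; exists del => // c b x bc cd bd xd xS.
  apply: contrapT => xN; apply: empty.
  have [ix [k [lam [l0 l1 ks act small]]]] := @approximate_kkt _ _ _ _ _ _ _ dZ_metric Tcpt
    f_convex g_convex g_cont c b bbar x del bc xS del0.
  exists (KktData c b x ix k lam); split; first split=> //=.
  - exact: le_lt_trans (norm_le_enorm _) cd.
  - exact: le_lt_trans (norm_le_enorm _) xd.
  - by split=> //; split=> //; case: xS.
(* The nonempty sets [P del] shrink with [del], which bounds both the distances and the stationarity
   error; they generate a proper filter. *)
have PF : ProperFilter (filter_from [set del : R | 0 < del] P).
  apply: filter_from_proper => //; apply: filter_from_filter; first by exists 1 => /=.
  move=> d1 d2 /= d10 d20; exists (Num.min d1 d2); first by rewrite /= lt_min d10.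
  move=> w [[wc wx wb ws] wr]; rewrite !lt_min in wc wx ws.
  case/andP: wc => wc1 wc2; case/andP: wx => wx1 wx2; case/andP: ws => ws1 ws2.
  by split; split=> //; split=> // t; have := wb t; rewrite lt_min => /andP[].
have [U [UU FU]] := ultraFilterLemma PF.
have UP del : 0 < del -> U (P del) by move=> del0; apply: FU; exists del.
have : U [set w | Sol f g (cbar, kd_b w) (kd_x w)].
  apply: (@kkt_limit _ U UU _ kd_c kd_x kd_b (fun i w => kd_o w i) (fun i w => kd_k w i)
    (fun i w => kd_lam w i)).
  - apply/cvgrPdist_lt => eps eps0; apply: filterS (UP _ eps0) => w [[wc _ _ _] _].
    by rewrite distrC.
  - apply/cvgrPdist_lt => eps eps0; apply: filterS (UP _ eps0) => w [[_ wx _ _] _].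
    by rewrite distrC.
  - by move=> eps eps0; apply: filterS (UP _ eps0) => w [[]].
  - by apply: filterS (UP _ ltr01) => w [_ [_ []]].
  - by apply: filterS (UP _ ltr01) => w [_ []].
  - by move=> eps eps0; apply: filterS (UP _ eps0) => w [[]].
move=> US; have /filter_ex[w [wS [_ [_ [_ wN]]]]] :
    U ([set w | Sol f g (cbar, kd_b w) (kd_x w)] `&` P 1).
  by apply: filterI => //; exact: UP.
exact: wN wS.
Qed.

End Stability.

(** * Equality of the two calmness moduli *)

Lemma quot_mono (R : realType) (p p' : R) (d : \bar R) : p <= p' -> (quot p d <= quot p' d)%E.
Proof.
move=> pp; case: d => [r| |] //=; case: ifP => // r0.
by rewrite lee_fin ler_wpM2r // invr_ge0 ltW.
Qed.

Lemma supnorm_ge0 (R : realType) (Z : Type) (T : set Z) (b : sig T -> R) : 0 <= supnorm b.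
Proof.
rewrite /supnorm; set A := (X in sup X).
(* [sup] is 0 by default on the empty set, which occurs for empty [T], and on unbounded sets. *)
have [[t Tt]|T0] := pselect (exists t : sig T, True); last first.
  have -> : A = set0 by rewrite -subset0 => r [t]; case: T0; exists t.
  by rewrite sup0.
have [Au|Au] := pselect (has_sup A); last by rewrite sup_out.
by apply: (le_trans (normr_ge0 (b t))); apply: ub_le_sup; [case: Au|exists t].
Qed.

Theorem theorem4p10 (R : realType) (n : nat) (Z : Type) (dZ : Z -> Z -> R)
  (T : set Z) (f : 'rV[R]_n -> R) (g : sig T -> 'rV[R]_n -> R) (q : R)
  (cbar : 'rV[R]_n) (bbar : sig T -> R) (xbar : 'rV[R]_n) :
  is_metric dZ -> compact_in dZ T -> T != setT ->
  convex_fun f -> (forall t, convex_fun (g t)) -> joint_cont dZ g ->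
  0 < q <= 1 ->
  cont_on dZ bbar -> Sol f g (cbar, bbar) xbar ->
  ENC f g cbar bbar xbar ->
  clm (fun cb : 'rV[R]_n * (sig T -> R) => cont_on dZ cb.2)
      (fun cb cb' => Num.max (enorm (cb.1 - cb'.1))
                             (supnorm (fun t => cb.2 t - cb'.2 t)))
      (fun x y : 'rV[R]_n => enorm (x - y))
      (Sol f g) q (cbar, bbar) xbar
  = clm (fun b : sig T -> R => cont_on dZ b)
        (fun b b' => supnorm (fun t => b t - b' t))
        (fun x y : 'rV[R]_n => enorm (x - y))
        (fun b => Sol f g (cbar, b)) q bbar xbar.
Proof.
move=> dZm Tcpt _ fc gc gcont /andP[q0 _] bbc _ enc; apply/le_anti/andP; split.
  (* Taking [c = cbar] embeds the points of the right-hand infimum, with the same quotients, into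
     those of the left-hand one. *)
  apply: ge_ereal_sup => _ [del /= del0 <-].
  apply: le_trans (ereal_sup_ubound _); last by exists del.
  apply: le_ereal_inf => _ [[b x] /= [bc [bd [xd xS]]] <-].
  exists (cbar, b, x) => /=; rewrite subrr enorm0 max_r ?supnorm_ge0 //.
have [del0 del0p stay] := optimal_unperturbed_cost dZm Tcpt fc gc gcont bbc enc.
apply: ge_ereal_sup => _ [del /= delp <-].
(* Below [del0], [x] stays optimal after [c] is replaced by [cbar]; this replacement can only
   decrease the distance of the parameters, hence the quotient. *)
pose del' := Num.min del del0.
apply: le_trans (ereal_sup_ubound _); last by exists del' => //=; rewrite lt_min delp.
apply: le_ereal_inf_tmp => _ [[[c b] x] /= [bc [cbd [xd xS]]] <-].
move: cbd xd; rewrite gt_max !lt_min => /andP[/andP[_ cd] /andP[bd bd0]] /andP[xd xd0].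
apply: le_trans (ereal_inf_lbound _) (quot_mono _ _).
  exists (b, x) => //=; split=> //; split=> //; split=> //.
  apply: (stay c) => // t; apply: le_lt_trans bd0.
  exact: (@le_supnorm _ _ dZ _ dZm Tcpt (fun t => b t - bbar t) t (cont_onB bc bbc)).
by apply: ge0_ler_powR; rewrite ?nnegrE ?le_max ?supnorm_ge0 ?lexx ?orbT // ltW.
Qed.
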